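(* Let $\mathbb{F}$ be a field and let $q\in\mathbb{F}^*$ be not a root of unity. Let $m,n$ be arbitrary positive integers, and let $f:\mathbb{Z}\to\mathbb{F}^*$ satisfy $f(i+n)=qf(i)$ for all $i\in\mathbb{Z}$. Then the representation $\mathsf{V}^{m,n}_f$ of the quantum plane $\mathbb{F}_q[x,y]$ is a weight representation if and only if $m=n$.
   Context: $\mathbb{F}$ is a field of arbitrary characteristic, not necessarily algebraically closed, with group of units $\mathbb{F}^*$. The quantum plane is the unital associative algebra $\mathbb{F}_q[x,y]=\mathbb{F}\{x,y\}/(yx-qxy)$ with generators $x,y$ and relation $yx=qxy$. Representations are left modules. For positive integers $m,n$ and $f:\mathbb{Z}\to\mathbb{F}^*$ with $f(i+n)=qf(i)$ for all $i\in\mathbb{Z}$, $\mathsf{V}^{m,n}_f$ denotes the representation of $\mathbb{F}_q[x,y]$ on the space $\mathbb{F}[t^{\pm1}]$ of Laurent polynomials given by $x.t^i=t^{i+n}$, $y.t^i=f(i)t^{i-m}$ for all $i\in\mathbb{Z}$. A representation of $\mathbb{F}_q[x,y]$ is a weight representation if it is semisimple as a representation of the polynomial subalgebra $\mathbb{F}[H]$ generated by $H=xy$. *)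

(* Defs.v *)
From HB Require Import structures.
From mathcomp Require Import all_boot all_order all_algebra finmap.
From mathcomp Require Import boolp monalg.

Set Implicit Arguments.
Unset Strict Implicit.
Unset Printing Implicit Defensive.

Import GRing.Theory.

Local Open Scope ring_scope.
Local Open Scope quotient_scope.

Section LinearExtension.
Variables (F : fieldType) (K : choiceType) (V : lmodType F) (h : K -> V).

(* [{malg F[K]}] is the vector space with basis [K]; [linext h] is the linear
   map sending the basis vector [<< k >>] to [h k]. *)
Definition linext (g : {malg F[K]}) : V := \sum_(k <- msupp g) g@_k *: h k.

Lemma linextEw (d : {fset K}) g :
  (msupp g `<=` d)%fset -> linext g = \sum_(k <- d) g@_k *: h k.
Proof.
move=> le; rewrite [LHS](big_fset_incl _ le) // => k kd /mcoeff_outdom ->.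
by rewrite scale0r.
Qed.

Lemma linextU c k : linext << c *g k >> = c *: h k.
Proof. by rewrite (linextEw msuppU_le) big_seq_fset1 mcoeffUU. Qed.

Lemma linext_is_linear : linear linext.
Proof.
move=> c g1 g2.
pose d := (msupp g1 `|` msupp g2)%fset.
have d1 : (msupp g1 `<=` d)%fset by exact: fsubsetUl.
have d2 : (msupp g2 `<=` d)%fset by exact: fsubsetUr.
have d3 : (msupp (c *: g1 + g2) `<=` d)%fset.
  apply: fsubset_trans (msuppD_le _ _) _; apply: fsetSU; exact: msuppZ_le.
rewrite !(linextEw d1, linextEw d2, linextEw d3) scaler_sumr -big_split /=.
by apply: eq_bigr => k _; rewrite mcoeffD mcoeffZ scalerDl scalerA.
Qed.

HB.instance Definition _ :=
  GRing.isLinear.Build F {malg F[K]} V *:%R linext linext_is_linear.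

End LinearExtension.

Lemma malg_ind (F : fieldType) (K : choiceType) (P : {malg F[K]} -> Prop) :
  P 0 -> (forall c k g, P g -> P (<< c *g k >> + g)) -> forall g, P g.
Proof.
move=> P0 PD g; rewrite [g]monalgE.
by elim: (enum_fset (msupp g)) => [|k s IH]; rewrite ?big_nil ?big_cons //; apply: PD.
Qed.

Lemma malg_scaleAr (F : comNzRingType) (M : monomType) (c : F)
  (a b : {malg F[M]}) : c *: (a * b) = a * (c *: b).
Proof.
apply/malgP => k; rewrite mcoeffZ mcoeffMl.
rewrite (@mcoeffMlw _ _ (msupp a) (msupp b) a (c *: b)) //.
  rewrite mulr_sumr; apply: eq_bigr => i _.
  rewrite mulr_sumr; apply: eq_bigr => j _.
  by rewrite mcoeffZ mulrnAr mulrCA.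
exact: msuppZ_le.
Qed.

Section MonomAction.
Variables (F : fieldType) (M : monomType) (V : lmodType F).
Variable h : M -> V -> V.
Hypothesis h_lin : forall w, linear (h w).
Hypothesis h1 : forall v, h mone v = v.
Hypothesis hM : forall w u v, h (mmul w u) v = h w (h u v).

Definition malg_act (a : {malg F[M]}) (v : V) : V := linext (h^~ v) a.

Lemma malg_actBl a b v : malg_act (a - b) v = malg_act a v - malg_act b v.
Proof. exact: linearB. Qed.
Lemma malg_actDl a b v : malg_act (a + b) v = malg_act a v + malg_act b v.
Proof. exact: linearD. Qed.
Lemma malg_actZl c a v : malg_act (c *: a) v = c *: malg_act a v.
Proof. exact: linearZ. Qed.
Lemma malg_act0l v : malg_act 0 v = 0.
Proof. exact: linear0. Qed.
Lemma malg_actU c w v : malg_act << c *g w >> v = c *: h w v.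
Proof. exact: linextU. Qed.

Lemma malg_act_linear a : linear (malg_act a).
Proof.
move=> c u v; elim/malg_ind: a => [|d w g IH].
  by rewrite !malg_act0l scaler0 addr0.
rewrite !malg_actDl IH !malg_actU h_lin !scalerDr !scalerA.
by rewrite [d * c]mulrC addrACA.
Qed.

Lemma malg_actDr a u v : malg_act a (u + v) = malg_act a u + malg_act a v.
Proof. by rewrite -[u]scale1r malg_act_linear !scale1r. Qed.
Lemma malg_act0r a : malg_act a 0 = 0.
Proof. by apply: (addrI (malg_act a 0)); rewrite -malg_actDr !addr0. Qed.
Lemma malg_actZr a c v : malg_act a (c *: v) = c *: malg_act a v.
Proof. by rewrite -[_ *: v]addr0 malg_act_linear malg_act0r addr0. Qed.

Lemma malg_act1 v : malg_act 1 v = v.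
Proof. by rewrite malg_actU scale1r h1. Qed.

Lemma malg_actM a b v : malg_act (a * b) v = malg_act a (malg_act b v).
Proof.
elim/malg_ind: a => [|c w g IH]; first by rewrite mul0r !malg_act0l.
rewrite mulrDl !malg_actDl IH; congr (_ + _).
elim/malg_ind: b {IH} => [|d u b IH].
  by rewrite mulr0 malg_act0l malg_act0r.
rewrite mulrDr !malg_actDl malg_actDr IH; congr (_ + _).
rewrite [_ * _](@fgmulUU _ _ c d w u) !malg_actU hM.
have h0 : h w 0 = 0.
  have /eqP := h_lin w 1 0 0; rewrite !scale1r addr0.
  by rewrite -subr_eq0 opprD addrA subrr sub0r oppr_eq0 => /eqP.
by rewrite -[d *: _]addr0 h_lin h0 addr0 scalerA.
Qed.

End MonomAction.

Lemma rmorph_rel0 (F : fieldType) (A : algType F) (ev : {rmorphism A -> F})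
  (c : F) (a b : A) : ev a = 0 -> ev b = 0 -> ev (b * a - c *: (a * b)) = 0.
Proof.
move=> a0 b0; rewrite rmorphB /= -mulr_algl !rmorphM /= a0 b0.
by rewrite !mulr0 subrr.
Qed.

Section IdealQuotient.
Variables (F : fieldType) (A : algType F) (r : A).

(* The two-sided ideal generated by [r]. *)
Definition ideal_gen : {pred A} :=
  fun a => `[< exists s : seq (A * A), a = \sum_(p <- s) p.1 * r * p.2 >].

Lemma ideal_genP a :
  reflect (exists s : seq (A * A), a = \sum_(p <- s) p.1 * r * p.2)
          (a \in ideal_gen).
Proof. exact: asboolP. Qed.

Lemma ideal_gen_zmod_closed : zmod_closed ideal_gen.
Proof.
split=> [|a b /ideal_genP[s ->] /ideal_genP[t ->]]; apply/ideal_genP.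
  by exists [::]; rewrite big_nil.
exists (s ++ [seq (- p.1, p.2) | p <- t]); rewrite big_cat big_map /=.
by congr (_ + _); rewrite -sumrN; apply: eq_bigr => p _; rewrite !mulNr.
Qed.

HB.instance Definition _ :=
  GRing.isZmodClosed.Build A ideal_gen ideal_gen_zmod_closed.

Lemma ideal_genMl a b : b \in ideal_gen -> a * b \in ideal_gen.
Proof.
case/ideal_genP=> s ->; apply/ideal_genP; exists [seq (a * p.1, p.2) | p <- s].
by rewrite big_map mulr_sumr; apply: eq_bigr => p _; rewrite !mulrA.
Qed.

Lemma ideal_genMr a b : a \in ideal_gen -> a * b \in ideal_gen.
Proof.
case/ideal_genP=> s ->; apply/ideal_genP; exists [seq (p.1, p.2 * b) | p <- s].
by rewrite big_map mulr_suml; apply: eq_bigr => p _; rewrite !mulrA.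
Qed.

Lemma ideal_genZ c a : a \in ideal_gen -> c *: a \in ideal_gen.
Proof. by move=> aI; rewrite -[a]mul1r scalerAl; apply: ideal_genMl. Qed.

Lemma ideal_gen_proper (ev : {rmorphism A -> F}) :
  ev r = 0 -> 1 \notin ideal_gen.
Proof.
move=> ev_r; apply/ideal_genP => -[s e]; have /eqP := congr1 ev e.
rewrite rmorph1 raddf_sum big1 ?oner_eq0 // => p _ /=.
by rewrite !rmorphM ev_r mulr0 mul0r.
Qed.

Definition idealquot : Type := Quotient.quot ideal_gen.
HB.instance Definition _ := GRing.Zmodule.on idealquot.
HB.instance Definition _ := EqQuotient.on idealquot.

Definition qpi (a : A) : idealquot := \pi_idealquot a.

Lemma qpi_eq a b : (qpi a = qpi b) <-> (a - b \in ideal_gen).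
Proof. by rewrite Quotient.idealrBE; split=> [/eqP //|/eqP]. Qed.

Lemma qpiK (a : idealquot) : qpi (repr a) = a. Proof. exact: reprK. Qed.

Lemma qpi_repr a : repr (qpi a) - a \in ideal_gen.
Proof. by apply/qpi_eq; rewrite qpiK. Qed.

Lemma qpiP (P : idealquot -> Prop) : (forall a, P (qpi a)) -> forall a, P a.
Proof. by move=> h a; rewrite -[a]qpiK. Qed.

Lemma qpiD a b : qpi (a + b) = qpi a + qpi b.
Proof. exact: (raddfD (\pi_(Quotient.quot ideal_gen))). Qed.

Definition qone : idealquot := qpi 1.
Definition qmul (a b : idealquot) : idealquot := qpi (repr a * repr b).
Definition qscale (c : F) (a : idealquot) : idealquot := qpi (c *: repr a).

Lemma qmul_pi a b : qmul (qpi a) (qpi b) = qpi (a * b).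
Proof.
apply/qpi_eq.
have -> : repr (qpi a) * repr (qpi b) - a * b =
  repr (qpi a) * (repr (qpi b) - b) + (repr (qpi a) - a) * b.
  by rewrite mulrBr mulrBl addrA subrK.
by apply: rpredD; [apply: ideal_genMl | apply: ideal_genMr]; apply: qpi_repr.
Qed.

Lemma qscale_pi c a : qscale c (qpi a) = qpi (c *: a).
Proof. by apply/qpi_eq; rewrite -scalerBr; apply/ideal_genZ/qpi_repr. Qed.

Lemma qmulA : associative qmul.
Proof.
by elim/qpiP=> a; elim/qpiP=> b; elim/qpiP=> c; rewrite !qmul_pi mulrA.
Qed.
Lemma qmul1l : left_id qone qmul.
Proof. by elim/qpiP=> a; rewrite qmul_pi mul1r. Qed.
Lemma qmul1r : right_id qone qmul.
Proof. by elim/qpiP=> a; rewrite qmul_pi mulr1. Qed.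
Lemma qmulDl : left_distributive qmul +%R.
Proof.
elim/qpiP=> a; elim/qpiP=> b; elim/qpiP=> c.
by rewrite -qpiD !qmul_pi mulrDl qpiD.
Qed.
Lemma qmulDr : right_distributive qmul +%R.
Proof.
elim/qpiP=> a; elim/qpiP=> b; elim/qpiP=> c.
by rewrite -qpiD !qmul_pi mulrDr qpiD.
Qed.

HB.instance Definition _ := GRing.Zmodule_isPzRing.Build idealquot
  qmulA qmul1l qmul1r qmulDl qmulDr.

Lemma qscaleA a b v : qscale a (qscale b v) = qscale (a * b) v.
Proof. by elim/qpiP: v => v; rewrite !qscale_pi scalerA. Qed.
Lemma qscale1 : left_id 1 qscale.
Proof. by elim/qpiP=> v; rewrite qscale_pi scale1r. Qed.
Lemma qscaleDr : right_distributive qscale +%R.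
Proof.
move=> c; elim/qpiP=> a; elim/qpiP=> b.
by rewrite -qpiD !qscale_pi scalerDr qpiD.
Qed.
Lemma qscaleDl v : {morph qscale^~ v : a b / a + b}.
Proof. by move=> a b; elim/qpiP: v => v; rewrite !qscale_pi scalerDl qpiD. Qed.

HB.instance Definition _ := GRing.Zmodule_isLmodule.Build F idealquot
  qscaleA qscale1 qscaleDr qscaleDl.

Lemma qpiM a b : qpi (a * b) = qpi a * qpi b.
Proof. by rewrite -[RHS]/(qmul _ _) qmul_pi. Qed.
Lemma qpi1 : qpi 1 = 1. Proof. by []. Qed.
Lemma qpiZ c a : qpi (c *: a) = c *: qpi a.
Proof. by rewrite -[RHS]/(qscale _ _) qscale_pi. Qed.

Lemma qscaleAl (c : F) (a b : idealquot) : c *: (a * b) = c *: a * b.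
Proof.
elim/qpiP: a => a; elim/qpiP: b => b.
by rewrite -qpiM -!qpiZ -qpiM scalerAl.
Qed.

Lemma qscaleAr (c : F) (a b : idealquot) : c *: (a * b) = a * (c *: b).
Proof.
elim/qpiP: a => a; elim/qpiP: b => b.
by rewrite -qpiM -!qpiZ -qpiM scalerAr.
Qed.

Lemma qpi0 : qpi 0 = 0.
Proof. by apply: (addrI (qpi 0)); rewrite -qpiD !addr0. Qed.

Lemma ideal_gen_rel : r \in ideal_gen.
Proof.
by apply/ideal_genP; exists [:: (1, 1)]; rewrite big_seq1 /= mul1r mulr1.
Qed.

Lemma qpi_rel_eq a b c d e : r = a * b - c *: (d * e) ->
  qpi a * qpi b = c *: (qpi d * qpi e).
Proof.
by move=> re; rewrite -!qpiM -qpiZ; apply/qpi_eq; rewrite -re ideal_gen_rel.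
Qed.

Section Action.
Variables (V : zmodType) (act : A -> V -> V).
Hypothesis actA : forall a b v, act a (act b v) = act (a * b) v.
Hypothesis act1 : left_id 1 act.
Hypothesis actDr : right_distributive act +%R.
Hypothesis actDl : forall v, {morph act^~ v : a b / a + b}.
Hypothesis act_rel : forall v, act r v = 0.

(* A class acts through any of its representatives. *)
Definition quot_act (a : idealquot) (v : V) : V := act (repr a) v.

Lemma act_ideal a v : a \in ideal_gen -> act a v = 0.
Proof.
have act0r b : act b 0 = 0 by apply: (addrI (act b 0)); rewrite -actDr !addr0.
have act0l u : act 0 u = 0.
  by apply: (addrI (act 0 u)); rewrite -(actDl u) !addr0.
case/ideal_genP=> s ->; elim: s => [|p s IH]; first by rewrite big_nil act0l.
by rewrite big_cons (actDl v) IH addr0 -!actA act_rel act0r.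
Qed.

Lemma quot_act_pi a v : quot_act (qpi a) v = act a v.
Proof.
rewrite /quot_act -[repr _](subrK a) (actDl v).
by rewrite act_ideal ?add0r // qpi_repr.
Qed.

Lemma quot_actA a b v : quot_act a (quot_act b v) = quot_act (a * b) v.
Proof.
by elim/qpiP: a => a; elim/qpiP: b => b; rewrite -qpiM !quot_act_pi actA.
Qed.
Lemma quot_act1 : left_id 1 quot_act.
Proof. by move=> v; rewrite -qpi1 quot_act_pi act1. Qed.
Lemma quot_actDr : right_distributive quot_act +%R.
Proof. by move=> a u v; exact: actDr. Qed.
Lemma quot_actDl v : {morph quot_act^~ v : a b / a + b}.
Proof.
by elim/qpiP=> a; elim/qpiP=> b; rewrite -qpiD !quot_act_pi (actDl v).
Qed.

End Action.

End IdealQuotient.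

Section QuantumPlane.
Variable F : fieldType.

(* The free algebra [F{x,y}]: monomials are words over [bool], where [false]
   stands for [x] and [true] for [y]. *)
Definition freealg : Type := {malg F[{fmonom bool}]}.
HB.instance Definition _ := GRing.Lalgebra.on freealg.
HB.instance Definition _ := GRing.Lalgebra_isAlgebra.Build F freealg
  (@malg_scaleAr F {fmonom bool}).

Definition freex : freealg := (<< fmu false >> : {malg F[{fmonom bool}]}).
Definition freey : freealg := (<< fmu true >> : {malg F[{fmonom bool}]}).

Variable q : F.

Definition qrel : freealg := freey * freex - q *: (freex * freey).

Lemma qrel_proper : 1 \notin ideal_gen qrel.
Proof.
pose ev : {rmorphism freealg -> F} :=
  (mcoeff (mone : {fmonom bool}) : {rmorphism {malg F[{fmonom bool}]} -> F}).
have gen0 b : ev (<< fmu b >> : {malg F[{fmonom bool}]}) = 0.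
  rewrite [LHS]mcoeffU; case: eqP => // /(congr1 (@fmonom_val _)).
  by rewrite fm1 fmU.
exact: (ideal_gen_proper (rmorph_rel0 q (gen0 false) (gen0 true))).
Qed.

Definition qplane : Type := idealquot qrel.
HB.instance Definition _ := GRing.PzRing.on qplane.
HB.instance Definition _ := GRing.Lmodule.on qplane.

Lemma qplane_oner_neq0 : (1 : qplane) != 0.
Proof.
rewrite -[1]/(qpi qrel 1); apply/eqP; rewrite -(qpi0 qrel) => /qpi_eq.
by rewrite subr0; apply/negP/qrel_proper.
Qed.

HB.instance Definition _ := GRing.PzSemiRing_isNonZero.Build qplane
  qplane_oner_neq0.
HB.instance Definition _ := GRing.Lmodule_isLalgebra.Build F qplane
  (@qscaleAl F freealg qrel).
HB.instance Definition _ := GRing.Lalgebra_isAlgebra.Build F qplane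
  (@qscaleAr F freealg qrel).

Definition qx : qplane := qpi qrel freex.
Definition qy : qplane := qpi qrel freey.
Definition qH : qplane := qx * qy.

Lemma qyx : qy * qx = q *: (qx * qy).
Proof.
exact: (qpi_rel_eq (r := qrel) erefl).
Qed.

End QuantumPlane.

Section Action.
Variables (F : fieldType) (q : F) (V : lmodType F) (X Y : {linear V -> V}).
Hypothesis YX : forall v, Y (X v) = q *: X (Y v).

(* A word [b1 b2 ... bk] acts as the composite [b1 \o b2 \o ... \o bk]. *)
Definition word_act (w : {fmonom bool}) (v : V) : V :=
  foldr (fun b u => if b then Y u else X u) v w.

Lemma word_act_linear w : linear (word_act w).
Proof.
by rewrite /word_act; elim: (w : seq bool) => [|[] s IH] c u v //=;
  rewrite IH linearP.
Qed.
Lemma word_act1 v : word_act mone v = v.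
Proof. by rewrite /word_act fm1. Qed.
Lemma word_actM w u v : word_act (mmul w u) v = word_act w (word_act u v).
Proof. by rewrite /word_act fmM foldr_cat. Qed.

Definition free_act : freealg F -> V -> V := malg_act word_act.

Lemma free_actA a b v : free_act a (free_act b v) = free_act (a * b) v.
Proof. by rewrite [RHS](malg_actM word_act_linear word_actM). Qed.
Lemma free_act1 : left_id 1 free_act.
Proof. exact: malg_act1 word_act1. Qed.
Lemma free_actDr : right_distributive free_act +%R.
Proof. exact: malg_actDr word_act_linear. Qed.
Lemma free_actDl v : {morph free_act^~ v : a b / a + b}.
Proof. by move=> a b; exact: (malg_actDl word_act a b v). Qed.
Lemma free_actZl c a v : free_act (c *: a) v = c *: free_act a v.
Proof. exact: malg_actZl. Qed.

Lemma free_act_x v : free_act (freex F) v = X v.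
Proof. by rewrite [LHS]malg_actU scale1r /word_act fmU. Qed.
Lemma free_act_y v : free_act (freey F) v = Y v.
Proof. by rewrite [LHS]malg_actU scale1r /word_act fmU. Qed.

Lemma free_act_rel v : free_act (qrel q) v = 0.
Proof.
rewrite [LHS]malg_actBl -[malg_act _ _ _]free_actA free_act_y free_act_x.
rewrite [malg_act _ (q *: _) _]free_actZl -free_actA free_act_y free_act_x.
by rewrite YX subrr.
Qed.

Definition qact : qplane q -> V -> V := quot_act free_act.

Lemma qact_pi a v : qact (qpi (qrel q) a) v = free_act a v.
Proof. exact: (quot_act_pi free_actA free_actDr free_actDl free_act_rel). Qed.
Lemma qactA a b v : qact a (qact b v) = qact (a * b) v.
Proof. exact: (quot_actA free_actA free_actDr free_actDl free_act_rel). Qed.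
Lemma qact1 : left_id 1 qact.
Proof.
exact: (quot_act1 free_actA free_act1 free_actDr free_actDl free_act_rel).
Qed.
Lemma qactDr : right_distributive qact +%R.
Proof. exact: quot_actDr free_actDr. Qed.
Lemma qactDl v : {morph qact^~ v : a b / a + b}.
Proof. exact: (quot_actDl free_actA free_actDr free_actDl free_act_rel). Qed.

End Action.

(* The space of Laurent polynomials, with basis [t^i], [i : int]. *)
Notation laurent F := {malg F[int]}.

Section LaurentRep.
Variables (F : fieldType) (q : F) (m n : nat) (f : int -> F).

Definition tpow (i : int) : laurent F := << i >>.

Definition lx : laurent F -> laurent F :=
  linext (fun i => tpow (i + n%:Z)).
Definition ly : laurent F -> laurent F :=
  linext (fun i => f i *: tpow (i - m%:Z)).
HB.instance Definition _ := GRing.Linear.on lx.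
HB.instance Definition _ := GRing.Linear.on ly.

Hypothesis hf : forall i : int, f (i + n%:Z) = q * f i.

Lemma lx_tpow i : lx (tpow i) = tpow (i + n%:Z).
Proof. by rewrite /lx linextU scale1r. Qed.
Lemma ly_tpow i : ly (tpow i) = f i *: tpow (i - m%:Z).
Proof. by rewrite /ly linextU scale1r. Qed.

Lemma tpowZ c i : << c *g i >> = c *: tpow i.
Proof. by apply/malgP => k; rewrite mcoeffZ !mcoeffU mulrnAr mulr1. Qed.

Lemma lyx v : ly (lx v) = q *: lx (ly v).
Proof.
elim/malg_ind: v => [|c i g IH]; first by rewrite !linear0.
have lxD : {morph lx : u v / u + v} by exact: linearD.
have lyD : {morph ly : u v / u + v} by exact: linearD.
have lxZ d u : lx (d *: u) = d *: lx u by exact: linearZ.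
have lyZ d u : ly (d *: u) = d *: ly u by exact: linearZ.
rewrite !(lxD, lyD) scalerDr IH; congr (_ + _).
rewrite tpowZ !(lxZ, lyZ, lx_tpow, ly_tpow) hf !scalerA [q * (c * _)]mulrCA.
by rewrite addrAC ?mulrA.
Qed.

End LaurentRep.

Arguments tpow {F} i.

(* [V_f^{m,n}]: the hypothesis on [f] is a parameter of the type, since it makes
   the action of the free algebra factor through the quantum plane; [m] does not
   occur in the carrier and only selects the module structure. *)
Definition Vrep (F : fieldType) (q : F) (m n : nat) (f : int -> F)
  (hf : forall i : int, f (i + n%:Z) = q * f i) : Type := laurent F.
Arguments Vrep {F q} m {n f} hf.

Section LaurentModule.
Variables (F : fieldType) (q : F) (m n : nat) (f : int -> F).
Hypothesis hf : forall i : int, f (i + n%:Z) = q * f i.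

Local Notation lx := (@lx F n).
Local Notation ly := (@ly F m f).
Local Notation lyx := (lyx m hf).

HB.instance Definition _ := GRing.Zmodule.on (Vrep m hf).
HB.instance Definition _ := GRing.Zmodule_isLmodule.Build (qplane q) (Vrep m hf)
  (qactA lyx) (qact1 lyx) (@qactDr _ _ _ lx ly) (qactDl lyx).

Lemma Vrep_x i : qx q *: (tpow i : Vrep m hf) = tpow (i + n%:Z).
Proof. rewrite -[LHS]/(qact lx ly _ _) (qact_pi lyx) free_act_x; exact: lx_tpow. Qed.

Lemma Vrep_y i : qy q *: (tpow i : Vrep m hf) = f i *: tpow (i - m%:Z).
Proof. rewrite -[LHS]/(qact lx ly _ _) (qact_pi lyx) free_act_y; exact: ly_tpow. Qed.

(* The field acts through [F -> F_q[x,y]] by its usual scaling. *)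
Lemma Vrep_scalar c (v : Vrep m hf) : c%:A *: v = c *: (v : laurent F).
Proof.
rewrite -[LHS]/(qact lx ly (c *: qpi (qrel q) 1) v) -qpiZ (qact_pi lyx).
by rewrite free_actZl free_act1.
Qed.

End LaurentModule.

Section GeneratedSubalgebra.
Variables (F : fieldType) (A : algType F) (h : A).

(* The carrier of the subalgebra [F[h]]: the values at [h] of polynomials. *)
Definition polysub : {pred A} := fun a => `[< exists p, a = horner_alg h p >].

Lemma polysub_subalg_closed : subalg_closed polysub.
Proof.
split=> [|c a b /asboolP[p ->] /asboolP[r ->]|a b /asboolP[p ->] /asboolP[r ->]].
- by apply/asboolP; exists 1; rewrite rmorph1.
- by apply/asboolP; exists (c%:P * p + r); rewrite rmorphD rmorphM /= horner_algC mulr_algl.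
- by apply/asboolP; exists (p * r); rewrite rmorphM.
Qed.

HB.instance Definition _ := GRing.isSubalgClosed.Build F A polysub
  polysub_subalg_closed.

Record polysubalg := Polysubalg {
  polysub_val :> A; polysub_valP : polysub_val \in polysub }.

HB.instance Definition _ := [isSub for polysub_val].
HB.instance Definition _ := [Choice of polysubalg by <:].
HB.instance Definition _ := [SubChoice_isSubAlgebra of polysubalg by <:].

Lemma polysub_gen : h \in polysub.
Proof. by apply/asboolP; exists 'X; rewrite horner_algX. Qed.

End GeneratedSubalgebra.

Section Restriction.
Variables (S R : pzRingType) (phi : {rmorphism S -> R}) (V : lmodType R).

(* [V] seen as an [S]-module through [phi]. *)
Definition restrict_scalars of {rmorphism S -> R} : Type := V.
HB.instance Definition _ := GRing.Zmodule.on (restrict_scalars phi).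

Definition res_scale (a : S) (v : restrict_scalars phi) : restrict_scalars phi := phi a *: (v : V).

Lemma res_scaleA a b v : res_scale a (res_scale b v) = res_scale (a * b) v.
Proof. by rewrite /res_scale scalerA rmorphM. Qed.
Lemma res_scale1 : left_id 1 res_scale.
Proof. by move=> v; rewrite /res_scale rmorph1 scale1r. Qed.
Lemma res_scaleDr : right_distributive res_scale +%R.
Proof. by move=> a u v; rewrite /res_scale scalerDr. Qed.
Lemma res_scaleDl v : {morph res_scale^~ v : a b / a + b}.
Proof. by move=> a b; rewrite /res_scale rmorphD scalerDl. Qed.

HB.instance Definition _ := GRing.Zmodule_isLmodule.Build S (restrict_scalars phi)
  res_scaleA res_scale1 res_scaleDr res_scaleDl.

End Restriction.

Section Semisimple.
Variables (R : pzRingType) (V : lmodType R).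

(* Submodules are boolean predicates; classically these are arbitrary
   subsets. *)
Definition simple_submod (U : {pred V}) : Prop :=
  [/\ submod_closed U,
      exists2 u, u \in U & u != 0
    & forall W : {pred V}, submod_closed W -> {subset W <= U} ->
        {in W, forall w, w = 0} \/ {subset U <= W}].

(* [V] is the internal direct sum of the [U i]: every vector is a finite sum of
   vectors of the [U i], and such sums vanish only trivially. *)
Definition is_direct_sum (I : choiceType) (U : I -> {pred V}) : Prop :=
  (forall v : V, exists (J : {fset I}) (w : I -> V),
     (forall i, w i \in U i) /\ v = \sum_(i <- J) w i)
  /\ (forall (J : {fset I}) (w : I -> V),
       (forall i, w i \in U i) -> \sum_(i <- J) w i = 0 ->
       forall i, i \in J -> w i = 0).

Definition semisimple : Prop :=
  exists (I : choiceType) (U : I -> {pred V}),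
    (forall i, simple_submod (U i)) /\ is_direct_sum U.

End Semisimple.

Definition weight_rep (F : fieldType) (q : F) (V : lmodType (qplane q)) : Prop :=
  semisimple (restrict_scalars V (val : polysubalg (qH q) -> qplane q)).

(* Main.v *)
Require Import Defs.
From HB Require Import structures.
From mathcomp Require Import all_boot all_order all_algebra finmap.
From mathcomp Require Import boolp monalg.

Import Order.TTheory GRing.Theory Num.Theory.
Local Open Scope ring_scope.

(** On the basis of monomials, [H = xy] acts by [H t^i = f(i) t^(i + d)] with
[d = n - m].  If [d = 0], every [t^i] is an eigenvector of [H], so the
representation is the direct sum of the lines [F t^i], which are simple over
[F[H]].  If [d != 0], no nonzero submodule is simple
([simple_submod_fixed], [qH_move_support]): were [U] simple and [u] a nonzero
vector of [U], then [H u != 0] because all [f(i)] are nonzero, so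
[F[H] H u = U] and [u = a H u] for some [a] in [F[H]].  But [H] shifts
supports in the direction of the sign of [d] and no element of [F[H]] shifts
them back, so the extreme coefficient of [u] on the side opposite to [d] does
not occur in [a H u]. *)

(** A simple module is generated by each of its nonzero vectors, in particular
by [h *: u] unless it vanishes. *)
Lemma simple_submod_fixed (R : pzRingType) (V : lmodType R) (U : {pred V})
    (h : R) (u : V) :
  simple_submod U -> u \in U -> h *: u != 0 ->
  exists a : R, u = a *: (h *: u).
Proof.
case=> -[U0 Ulin] _ Umin uU hu0.
pose W : {pred V} := fun v => `[< exists a : R, v = a *: (h *: u) >].
have WE v : v \in W = `[< exists a : R, v = a *: (h *: u) >] by [].
have Wsub : submod_closed W.
  split=> [|c v w]; first by rewrite WE; apply/asboolP; exists 0; rewrite scale0r.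
  rewrite !WE => /asboolP[a ->] /asboolP[b ->]; apply/asboolP.
  by exists (c * a + b); rewrite scalerDl scalerA.
have WU : {subset W <= U}.
  move=> v; rewrite WE => /asboolP[a ->].
  by rewrite scalerA -[_ *: u]addr0; apply: Ulin.
have [W0|UW] := Umin W Wsub WU.
  by case/eqP: hu0; apply: W0; rewrite WE; apply/asboolP; exists 1; rewrite scale1r.
by have := UW u uU; rewrite WE => /asboolP.
Qed.

Lemma semisimple_has_simple (R : pzRingType) (V : lmodType R) (v : V) :
  semisimple V -> v != 0 -> exists U : {pred V}, simple_submod U.
Proof.
case=> I [U [Usimple [Uspan _]]] v0.
have [J [w [_ vE]]] := Uspan v.
case: (fset_0Vmem J) => [J0|[i _]]; last by exists (U i).
by case/eqP: v0; rewrite vE J0 big_seq_fset0.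
Qed.

Section HAction.
Variables (F : fieldType) (q : F) (m n : nat) (f : int -> F).
Hypothesis hf : forall i : int, f (i + n%:Z) = q * f i.

Local Notation V := (Vrep m hf).
Local Notation d := (n%:Z - m%:Z).

Lemma qH_act (v : V) : qH q *: v = @lx F n (@ly F m f v).
Proof.
rewrite /qH -scalerA.
rewrite -[LHS]/(qact (@lx F n) (@ly F m f) (qx q)
                 (qact (@lx F n) (@ly F m f) (qy q) v)).
by rewrite !(qact_pi (lyx m hf)) free_act_x free_act_y.
Qed.

Lemma qH_scale c (v : laurent F) :
  qH q *: (c *: v : V) = c *: (qH q *: (v : V) : laurent F).
Proof.
have lxZ u : lx n (c *: u) = c *: lx n u by exact: linearZ.
have lyZ u : ly m f (c *: u) = c *: ly m f u by exact: linearZ.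
by rewrite !qH_act lyZ lxZ.
Qed.

Lemma qH_tpow i : qH q *: (tpow i : V) = f i *: tpow (i + d).
Proof.
have lxZ c u : lx n (c *: u) = c *: lx n u :> laurent F by exact: linearZ.
by rewrite qH_act ly_tpow lxZ lx_tpow addrAC addrA.
Qed.

Lemma mcoeff_qH (v : V) i :
  mcoeff (i + d) (qH q *: v : V) = f i * mcoeff i (v : laurent F).
Proof.
elim/malg_ind: (v : laurent F) => [|c k g IH].
  by rewrite [_ *: _]scaler0 !mcoeff0 mulr0.
rewrite [_ *: _](scalerDr (qH q) (<< c *g k >> : V) g).
rewrite !mcoeffD mulrDr -IH; congr (_ + _).
rewrite tpowZ qH_scale qH_tpow !mcoeffZ !mcoeffU (inj_eq (addIr _)).
by case: eqP => [->|_]; rewrite ?mulr1 ?mulr0 // mulrC.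
Qed.

Lemma mcoeff_scalar c (v : V) i :
  mcoeff i (c%:A *: v : V) = c * mcoeff i (v : laurent F).
Proof. by rewrite Vrep_scalar mcoeffZ. Qed.

(** The reason is that [F[H]] is generated as a ring by the scalars and [H]. *)
Lemma polysub_stable (P : V -> Prop) (a : qplane q) :
  (forall u v, P u -> P v -> P (u + v)) ->
  (forall c v, P v -> P (c%:A *: v)) ->
  (forall v, P v -> P (qH q *: v)) ->
  a \in polysub (qH q) -> forall v, P v -> P (a *: v).
Proof.
move=> PD PZ PH /asboolP[p ->].
elim/poly_ind: p => [|p c IH] v Pv.
  by rewrite rmorph0 -(scale0r 1); apply: PZ.
rewrite rmorphD rmorphM /= horner_algX horner_algC scalerDl -scalerA.
by apply: PD; [apply/IH/PH | apply: PZ].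
Qed.

(** The product [d * i] orders the exponents in the direction in which [H]
moves them, whatever the sign of [d]. *)
Definition vanish_upto (k : int) (v : V) : Prop :=
  forall i : int, (d * i <= k)%R -> mcoeff i (v : laurent F) = 0.

Lemma vanish_upto_qH k v :
  vanish_upto k v -> vanish_upto (k + d * d) (qH q *: v).
Proof.
move=> v0 i ik; rewrite -[i](subrK d) mcoeff_qH v0 ?mulr0 //.
by rewrite mulrBr lerBlDr.
Qed.

Lemma vanish_upto_polysub k a v :
  a \in polysub (qH q) -> vanish_upto k v -> vanish_upto k (a *: v).
Proof.
move=> aH; apply: (polysub_stable _ _ _ _ _ aH) 
  => [u w u0 w0 i ik|c w w0 i ik|w w0 i ik].
- by rewrite mcoeffD u0 // w0 // addr0.
- by rewrite mcoeff_scalar w0 // mulr0.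
- apply: (vanish_upto_qH _ _ w0); apply: le_trans ik _.
  by rewrite lerDl -expr2 sqr_ge0.
Qed.

Lemma vanish_upto_extreme (v : V) : v != 0 ->
  exists2 i, mcoeff i (v : laurent F) != 0 & vanish_upto (d * i - 1) v.
Proof.
move=> v0.
have [k0 k0v] : exists k, k \in msupp (v : laurent F).
  have [K0|[k kv]] := fset_0Vmem (msupp (v : laurent F)); last by exists k.
  case/eqP: v0; apply/(@malgP int F) => k.
  by rewrite mcoeff0 mcoeff_outdom // K0.
pose K := msupp (v : laurent F).
pose i := [arg min_(j < [` k0v]%fset in xpredT) d * val j]%O.
have imin j : j \in K -> (d * val i <= d * j)%R.
  move=> jK; rewrite /i; case: arg_minP => //= j' _.
  by move=> /(_ [` jK]%fset isT).
exists (val i); first by rewrite mcoeff_neq0; exact: valP i.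
move=> j; rewrite -ltzD1 subrK => ji.
apply: contraTeq ji; rewrite mcoeff_neq0 -leNgt; exact: imin.
Qed.

(** The extreme exponent of [u] opposite to the sign of [d] is moved away by
[H], and the rest of [F[H]] cannot produce it again. *)
Lemma qH_move_support (u : V) a : d != 0 -> u != 0 ->
  a \in polysub (qH q) -> u != a *: (qH q *: u).
Proof.
move=> d0 u0 aH; have [i ui uv] := vanish_upto_extreme u u0.
apply: contra_neq ui => uE; rewrite uE.
apply: (vanish_upto_polysub _ _ _ aH (vanish_upto_qH _ _ uv)).
by rewrite -addrA lerDl addrC subr_ge0 -gtz0_ge1 -expr2 exprn_even_gt0.
Qed.

Lemma qH_inj (f_neq0 : forall i, f i != 0) (u : V) : u != 0 -> qH q *: u != 0.
Proof.
move=> /vanish_upto_extreme[i ui _]; apply: contra_neq (mulf_neq0 (f_neq0 i) ui).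
by move=> uE; rewrite -mcoeff_qH uE mcoeff0.
Qed.

Local Notation R := (polysubalg (qH q)).
Local Notation VH := (restrict_scalars V (val : R -> qplane q)).

Definition gen_H : R := Polysubalg (polysub_gen (qH q)).

Lemma not_weight_rep : (forall i, f i != 0) -> m != n -> ~ weight_rep V.
Proof.
move=> f_neq0 mn ss.
have t0 : (tpow 0 : VH) != 0.
  apply/eqP => /(congr1 (mcoeff (0 : int) : laurent F -> F)).
  by rewrite mcoeffUU mcoeff0 => /eqP; rewrite oner_eq0.
have [U Us] := semisimple_has_simple _ _ _ ss t0.
have [_ [u uU u0] _] := Us.
have [a uE] := simple_submod_fixed _ _ _ gen_H _ Us uU (qH_inj f_neq0 u u0).
have d0 : d != 0 by rewrite subr_eq0 eqz_nat eq_sym.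
by have /eqP := qH_move_support u (val a) d0 u0 (valP a).
Qed.

Definition line (i : int) : {pred VH} :=
  fun v => `[< exists c : F, v = (c *: tpow i : laurent F) >].

Lemma lineP i v :
  reflect (exists c : F, v = (c *: tpow i : laurent F)) (v \in line i).
Proof. exact: asboolP. Qed.

(** For [m = n] the monomial [t^i] is an eigenvector of [H], and a submodule
over [F[H]] is in particular an [F]-subspace of the one-dimensional [line i]. *)
Lemma line_simple i : m = n -> simple_submod (line i).
Proof.
move=> mn; split.
- split=> [|a u v /lineP[b ->] /lineP[c ->]].
    by apply/lineP; exists 0; rewrite scale0r.
  have /lineP[b' ab] : (val a *: ((b *: tpow i : laurent F) : V) : V) \in line i.
    apply: (polysub_stable (fun v => v \in line i) _ _ _ _ (valP a)).
    + move=> ? ? /lineP[c1 ->] /lineP[c2 ->].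
      by apply/lineP; exists (c1 + c2); rewrite scalerDl.
    + move=> c1 ? /lineP[c2 ->].
      by apply/lineP; exists (c1 * c2); rewrite Vrep_scalar scalerA.
    + move=> ? /lineP[c1 ->]; apply/lineP; exists (c1 * f i).
      by rewrite qH_scale qH_tpow mn subrr addr0 scalerA.
    + by apply/lineP; exists b.
  apply/lineP; exists (b' + c); rewrite scalerDl -ab; exact: erefl.
- exists (tpow i : laurent F); first by apply/lineP; exists 1; rewrite scale1r.
  apply/eqP => /(congr1 (mcoeff i : laurent F -> F)).
  by rewrite mcoeffUU mcoeff0 => /eqP; rewrite oner_eq0.
- move=> W [W0 Wlin] WU.
  case: (pselect (forall w, w \in W -> w = 0)) => [|Wn0]; first by left.
  right=> v /lineP[b ->].
  have /existsNP[w /not_implyP[wW /eqP w0]] := Wn0.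
  have /lineP[c wE] := WU w wW.
  have c0 : c != 0.
    by apply: contra_neq w0 => c0; rewrite wE c0 scale0r.
  have := Wlin (b / c)%:A w 0 wW W0; rewrite addr0.
  by rewrite [_ *: w](@Vrep_scalar F q m n f hf (b / c) w) wE scalerA divfK.
Qed.

Lemma mcoeff_line i w (k : int) : w \in line i -> k != i ->
  mcoeff k (w : laurent F) = 0.
Proof.
by case/lineP=> c -> ki; rewrite mcoeffZ mcoeffU eq_sym (negPf ki) mulr0.
Qed.

Lemma line_direct_sum : is_direct_sum line.
Proof.
split=> [v|J w wU s0 i iJ].
  exists (msupp (v : laurent F)), (fun i => mcoeff i (v : laurent F) *: tpow i).
  split=> [i|]; first by apply/lineP; exists (mcoeff i (v : laurent F)).
  rewrite {1}[v](monalgE (v : laurent F)).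
  by apply: eq_bigr => i _; rewrite tpowZ.
have wi0 : mcoeff i (w i : laurent F) = 0.
  have := congr1 (mcoeff i : laurent F -> F) s0.
  (* Only the summand of index [i] has a coefficient at [t^i]. *)
  rewrite mcoeff0 (raddf_sum (mcoeff i : {additive laurent F -> F})) /=.
  rewrite (big_fsetD1 i) //= big1_fset ?addr0 // => j.
  by rewrite !inE => /andP[ji _] _; apply: (mcoeff_line j); rewrite // eq_sym.
apply/(@malgP int F) => k; rewrite mcoeff0.
by have [->|ki] := eqVneq k i; last exact: (mcoeff_line i).
Qed.

End HAction.

Theorem mainTheorem5 (F : fieldType) (q : F)
    (q_neq0 : q != 0)
    (q_not_root : forall k : nat, (0 < k)%N -> q ^+ k != 1)
    (m n : nat) (m_gt0 : (0 < m)%N) (n_gt0 : (0 < n)%N)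
    (f : int -> F)
    (f_neq0 : forall i : int, f i != 0)
    (hf : forall i : int, f (i + n%:Z) = q * f i) :
  weight_rep (Vrep m hf) <-> m = n.
Proof.
split=> [wt|mn].
  have [//|mn] := eqVneq m n.
  by case: (not_weight_rep F q m n f hf f_neq0 mn wt).
exists int, (line F q m n f hf); split=> [i|].
  exact: line_simple.
exact: line_direct_sum.
Qed.
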